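(* Let $G$ be a finite simple bipartite graph with (non-empty) partite sets $U$ and $W$. Then $$\mathcal M(G)\le\lambda_{\max}(G)\le\sqrt{\big(\tfrac14\log|U|+1\big)\big(\tfrac14\log|W|+1\big)}\,\mathcal M(G).$$
   Context: $\lambda_{\max}(G)$ is the largest eigenvalue of the adjacency matrix $A$ of $G$. For subsets $X,Y$ of the vertex set $V$, $e(X,Y)$ is the number of ordered pairs $(x,y)\in X\times Y$ with $xy$ an edge (equivalently $\xi^tA\eta$ for the characteristic vectors $\xi,\eta$), and $\mathcal M(G):=\max_{\emptyset\ne X,Y\subseteq V}e(X,Y)/\sqrt{|X||Y|}$. $\log$ is the natural logarithm. *)

(* Defs.v *)
From mathcomp Require Import classical_sets reals exp.
From mathcomp Require Import all_boot all_order all_algebra.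
From mathcomp Require Import spectral complex.

Set Implicit Arguments.
Unset Strict Implicit.
Unset Printing Implicit Defensive.

Import Order.TTheory GRing.Theory Num.Theory.
Local Open Scope ring_scope.

Definition simple_graph (T : finType) (adj : rel T) : Prop :=
  symmetric adj /\ irreflexive adj.

Definition bipartition (T : finType) (adj : rel T) (U W : {set T}) : Prop :=
  [/\ U :|: W = [set: T], [disjoint U & W],
      {in U &, forall x y, ~~ adj x y} & {in W &, forall x y, ~~ adj x y}].

Definition adjacency_mx (R : realType) (T : finType) (adj : rel T) :
    'M[R]_#|T| :=
  \matrix_(i, j) (adj (enum_val i) (enum_val j))%:R.

(* A supremum, which is attained for a simple graph with at least one vertex:
   see [lambda_maxP]. *)
Definition lambda_max (R : realType) (T : finType) (adj : rel T) : R :=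
  sup [set a : R | eigenvalue (adjacency_mx R adj) a]%classic.

Lemma symmetric_mx_eigenvalue (R : rcfType) n (A : 'M[R]_n) : (0 < n)%N -> A^T = A ->
  exists a, eigenvalue A a.
Proof.
move=> n0 sA; set f := real_complex R.
have [a Ha] := eigenvalue_closed (map_mx f A) n0.
suff [x xa] : exists x, a = f x.
  by exists x; move: Ha; rewrite !eigenvalue_root_char xa -map_char_poly fmorph_root.
have /eigenvalueP[v vA v0] := Ha.
pose w := map_mx (@Num.conj R[i]) v.
pose N := (v *m w^T) 0 0.
have NE : N = \sum_i `|v 0 i| ^+ 2.
  by rewrite /N mxE; apply: eq_bigr => i _; rewrite !mxE -normCK.
have N0 : N != 0.
  apply: contra v0; rewrite NE psumr_eq0; last by move=> i _; rewrite exprn_ge0.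
  move=> /allP h; apply/eqP/rowP => i; rewrite mxE; apply/eqP.
  by have := h i (mem_index_enum _); rewrite /= expf_eq0 /= normr_eq0.
have wA : w *m map_mx f A = a^* *: w.
  have -> : map_mx f A = map_mx (@Num.conj R[i]) (map_mx f A).
    by apply/matrixP => i j; rewrite !mxE; apply/esym/CrealP; rewrite complex_real.
  by rewrite /w -map_mxM vA map_mxZ.
have : a * N = a^* * N.
  have h1 : (v *m map_mx f A *m w^T) 0 0 = a * N by rewrite vA -scalemxAl mxE.
  have h2 : (v *m (w *m map_mx f A)^T) 0 0 = a^* * N.
    by rewrite wA linearZ /= -scalemxAr mxE.
  have sf : (map_mx f A)^T = map_mx f A.
    by apply/matrixP => i j; rewrite !mxE -[in LHS]sA mxE.
  by rewrite -h1 -h2 trmx_mul sf mulmxA.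
move/(mulIf N0)/esym/CrealP => ra; exists (complex.Re a).
by rewrite /f /= RRe_real.
Qed.

Lemma lambda_maxP (R : realType) (T : finType) (adj : rel T) :
  symmetric adj -> (0 < #|T|)%N ->
  eigenvalue (adjacency_mx R adj) (lambda_max R adj) /\
  forall a, eigenvalue (adjacency_mx R adj) a -> a <= lambda_max R adj.
Proof.
move=> sadj T0; set A := adjacency_mx R adj.
have [a0 Ha0] : exists a, eigenvalue A a.
  apply: symmetric_mx_eigenvalue => //; apply/matrixP => i j; by rewrite !mxE sadj.
have p0 : char_poly A != 0 by rewrite monic_neq0 ?char_poly_monic.
have [s Hs] : exists s : seq R, forall a, eigenvalue A a -> a \in s.
  have h (q : {poly R}) : q != 0 -> exists s : seq R, forall a, root q a -> a \in s.
    elim: {q}(size q) {-2}q (leqnn (size q)) => [|n IH] q; first by rewrite leqn0 size_poly_eq0 => ->.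
    move=> sq q0; case: (boolp.pselect (exists a, root q a)) => [[a /factor_theorem[r qr]]|no]; last first.
      by exists [::] => a ra; case: no; exists a.
    have r0 : r != 0 by apply: contra q0; rewrite qr => /eqP->; rewrite mul0r.
    have [||s hs] := IH r => //.
      by move: sq; rewrite qr size_Mmonic ?monicXsubC // size_XsubC addn2.
    exists (a :: s) => b; rewrite qr rootM root_XsubC inE => /orP[/hs->|->] //.
    by rewrite orbT.
  by have [s hs] := h _ p0; exists s => a; rewrite eigenvalue_root_char => /hs.
have [m Hm mmax] : exists2 m, eigenvalue A m & forall a, eigenvalue A a -> a <= m.
  have a0s : a0 \in [seq a <- s | eigenvalue A a] by rewrite mem_filter Ha0 Hs.
  pose t := [seq a <- s | eigenvalue A a].
  pose m := \big[Order.max/a0]_(a <- t) a.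
  exists m.
    rewrite /m big_seq; elim/big_ind : _ => [//|x y hx hy|x].
      by case: (leP x y).
    by rewrite mem_filter => /andP[].
  move=> a Ha; rewrite /m; apply: (le_bigmax_seq _ a xpredT id) => //.
  by rewrite mem_filter Ha Hs.
suff -> : lambda_max R adj = m by [].
apply/le_anti/andP; split.
  by apply: ge_sup; [exists a0|move=> a; apply: mmax].
by apply: ub_le_sup => //; exists m => a; apply: mmax.
Qed.

Definition edge_count (T : finType) (adj : rel T) (X Y : {set T}) : nat :=
  #|[set p in setX X Y | adj p.1 p.2]|.

(* The quotients are nonnegative, so the initial value [0] of the iterated
   maximum does not affect it when [T] is nonempty. *)
Definition max_density (R : realType) (T : finType) (adj : rel T) : R :=
  \big[Order.max/0]_(XY : {set T} * {set T} | (XY.1 != set0) && (XY.2 != set0))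
    ((edge_count adj XY.1 XY.2)%:R / Num.sqrt (#|XY.1| * #|XY.2|)%:R).

(* Main.v *)
(** Lower bound: the spectral theorem bounds [z A z^T] by [lambda_max * |z|^2];
    as [A] has nonnegative entries, [|z A z^T| <= |z| A |z|^T], and polarization
    yields the bilinear estimate [2 x A y^T <= lambda_max (|x|^2 + |y|^2)],
    applied to suitably scaled indicator vectors of [X] and [Y].

    Upper bound: replace a top eigenvector by its absolute values [x].  If
    [x_1 >= x_2 >= ...] on [U], summation by parts turns the bounds
    [a(X) <= K sqrt |X|] into [sum x_k a_k <= K sum x_k (sqrt k - sqrt (k-1))],
    and Cauchy-Schwarz leaves [sum (sqrt k - sqrt (k-1))^2], which is at most
    [1 + (1/4) log |U|] because [(sqrt k - sqrt (k-1))^2 <= (1/4) log (k/(k-1))]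
    for [k >= 2].  Doing this once on [U] and once on [W] gives the theorem. *)
Require Import Defs.
From mathcomp Require Import classical_sets reals exp.
From mathcomp Require Import all_boot all_order all_algebra.
From mathcomp Require Import spectral complex.
From mathcomp Require Import normedtype derive.
From mathcomp Require Import ring lra.

Import Order.TTheory GRing.Theory Num.Theory.
Import numFieldNormedType.Exports.
Local Open Scope ring_scope.

(** * Spectral bound for real symmetric quadratic forms *)

(** Over [R[i]] the matrix is Hermitian, so a unitary change of coordinates turns both sides into
    sums of the squared moduli of the [y 0 i], weighted by [D 0 i] and by [l]. *)
Lemma rayleigh_le (R : rcfType) n (A : 'M[R]_n) (l : R) :
  A^T = A -> (forall a, eigenvalue A a -> a <= l) ->
  forall x : 'rV[R]_n, (x *m A *m x^T) 0 0 <= l * (x *m x^T) 0 0.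
Proof.
move=> sA Al x; set f := real_complex R; set M := map_mx f A.
have realf m p (B : 'M_(m, p)) : map_mx f B \is a mxOver Num.real.
  by apply/mxOverP => i j; rewrite mxE complex_real.
have hM : M \is hermsymmx.
  apply: realsym_hermsym; last exact: realf.
  by apply/is_hermitianmxP; rewrite expr0 scale1r map_mx_id // /M map_trmx sA.
set P := spectralmx M; set D := spectral_diag M.
have PM : P *m M = diag_mx D *m P.
  have /hermitian_normalmx/orthomx_spectralP -> := hM.
  by rewrite !mulmxA mulmxV ?spectral_unit // mul1mx.
(* Row [i] of [P] is an eigenvector for [D 0 i], nonzero because [P] is invertible; as [D 0 i] is
   real, it comes from an eigenvalue of [A]. *)
have Dl i : D 0 i <= f l.
  have /mxOverP/(_ 0 i) Dr := hermitian_spectral_diag_real hM.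
  have DE : f (complex.Re (D 0 i)) = D 0 i by apply: RRe_real.
  rewrite -DE lecR; apply: Al.
  suff: eigenvalue M (D 0 i).
    by rewrite -DE !eigenvalue_root_char -map_char_poly fmorph_root.
  apply/eigenvalueP; exists (row i P).
    by rewrite -row_mul PM row_mul row_diag_mx -scalemxAl -rowE.
  apply/negP => /eqP Pi0; have := mulmxV (spectral_unit M).
  move=> /(congr1 (row i)); rewrite row_mul Pi0 mul0mx row1.
  by move/rowP/(_ i); rewrite !mxE !eqxx => /esym/eqP; rewrite oner_eq0.
pose C := (@Num.conj R[i]).
(* Coordinates of [x] in the orthonormal eigenbasis formed by the rows of [P]. *)
pose y := map_mx f x *m map_mx C P^T.
have yP : y *m P = map_mx f x.
  rewrite /y -(invmx_unitary (spectral_unitarymx M)) -mulmxA mulVmx ?mulmx1 //.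
  exact: spectral_unit.
have xC : map_mx f x^T = map_mx C P^T *m map_mx C y^T.
  rewrite -map_mxM -trmx_mul yP map_trmx.
  by apply/matrixP => i j; rewrite !mxE; apply/esym/CrealP; rewrite complex_real.
have PP : P *m map_mx C P^T = 1%:M by apply/unitarymxP/spectral_unitarymx.
have yE (d : 'rV_n) : (y *m diag_mx d *m map_mx C y^T) 0 0 =
    \sum_i d 0 i * `|y 0 i| ^+ 2.
  rewrite mxE; apply: eq_bigr => i _.
  by rewrite mul_mx_diag !mxE mulrAC -normCK mulrC.
rewrite -lecR rmorphM /= -/f.
have -> : f ((x *m A *m x^T) 0 0) = \sum_i D 0 i * `|y 0 i| ^+ 2.
  rewrite -yE -[LHS](mxE (map_mx_key) (fun i j => f ((x *m A *m x^T) i j)) 0 0).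
  rewrite -[matrix_of_fun _ _]/(map_mx f _) !map_mxM xC -yP -/M -!mulmxA.
  by rewrite (mulmxA P) PM -!mulmxA (mulmxA P) PP mul1mx.
have -> : f ((x *m x^T) 0 0) = \sum_i `|y 0 i| ^+ 2.
  have -> : \sum_i `|y 0 i| ^+ 2 = (y *m map_mx C y^T) 0 0.
    by rewrite mxE; apply: eq_bigr => i _; rewrite !mxE -normCK.
  rewrite -[LHS](mxE (map_mx_key) (fun i j => f ((x *m x^T) i j)) 0 0).
  rewrite -[matrix_of_fun _ _]/(map_mx f _) !map_mxM xC -yP -!mulmxA.
  by rewrite (mulmxA P) PP mul1mx.
by rewrite mulr_sumr ler_sum // => i _; rewrite ler_wpM2r ?exprn_ge0.
Qed.

(** * Logarithmic bound for the increments of the square root *)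

(** The mean value theorem on [[1, r]] is applied to [g], the right side minus the left, which
    vanishes at 1. *)
Lemma ln_lower_bound (R : realType) (r : R) :
  1 <= r -> 2 * (r - 1) <= (r + 1) * ln r.
Proof.
move=> r1.
pose g (x : R) := (x + 1) * ln x - 2 * (x - 1).
have dg (x : R) : 0 < x -> is_derive x 1 g (ln x + x^-1 - 1).
  move=> x0; have x0' := lt0r_neq0 x0; have D := is_derive1_ln x0.
  apply: is_derive_eq; rewrite /GRing.scale /=.
  by field.
have [||c cr] := @MVT_segment R g (fun x => ln x + x^-1 - 1) 1 r r1.
- by move=> x /itvP xr; apply: dg; rewrite (lt_trans ltr01) // xr.
- apply: derivable_within_continuous => x /itvP xr.
  by have [] := dg x; rewrite // (lt_le_trans ltr01) // xr.
have c0 : 0 < c by rewrite (lt_le_trans ltr01) // (itvP cr).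
rewrite {2}/g ln1 subrr !mulr0 subr0 subr0 => gr.
rewrite -subr_ge0 -/(g r) gr mulr_ge0 ?subr_ge0 //.
(* The inequality [ln (c^-1) <= c^-1 - 1] makes the derivative of [g] nonnegative at [c]. *)
have := @le_ln1Dx R (c^-1 - 1).
rewrite [1 + _]addrC subrK lnV ?posrE // ltrBDr addNr invr_gt0 => /(_ c0); lra.
Qed.

(** [ln_lower_bound] is used at the ratio of the two roots; passing from [ln] of a root to [ln] of
    its square turns the factor 1/2 into 1/4. *)
Lemma sqr_sqrt_step_le (R : realType) (k : nat) :
  (Num.sqrt k.+2%:R - Num.sqrt k.+1%:R : R) ^+ 2 <=
    4^-1 * (ln k.+2%:R - ln k.+1%:R).
Proof.
set a : R := Num.sqrt k.+1%:R; set b : R := Num.sqrt k.+2%:R.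
have a0 : 0 < a by rewrite sqrtr_gt0 ltr0n.
have b0 : 0 < b by rewrite sqrtr_gt0 ltr0n.
have a2 : a ^+ 2 = k.+1%:R by rewrite sqr_sqrtr ?ler0n.
have b2 : b ^+ 2 = k.+2%:R by rewrite sqr_sqrtr ?ler0n.
have ab : a <= b by rewrite ler_sqrt ?ltr0n // ler_nat.
have ba : b ^+ 2 - a ^+ 2 = 1 by rewrite a2 b2 -natrB // subSnn.
have r1 : 1 <= b / a by rewrite ler_pdivlMr ?mul1r.
have := ln_lower_bound _ _ r1.
rewrite ln_div ?posrE // -a2 -b2 !lnXn //; set L := ln b - ln a => h.
have {}h : 2 * (b - a) <= (b + a) * L.
  have -> : 2 * (b - a) = a * (2 * (b / a - 1)) by field; rewrite lt0r_neq0.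
  have -> : (b + a) * L = a * ((b / a + 1) * L) by field; rewrite lt0r_neq0.
  by rewrite ler_pM2l.
have -> : 4^-1 * (ln b *+ 2 - ln a *+ 2) = 2^-1 * L by rewrite /L; field.
(* Since [b^2 - a^2 = 1]. *)
have -> : (b - a) ^+ 2 = (b - a) / (b + a).
  apply: (mulIf (x := b + a)); first by rewrite lt0r_neq0 ?addr_gt0.
  rewrite divfK ?lt0r_neq0 ?addr_gt0 //; rewrite -[RHS]mulr1 -ba; ring.
rewrite ler_pdivrMr ?addr_gt0 //; lra.
Qed.

(** The term [k = 0] contributes the 1; the logarithmic bounds on the later terms telescope. *)
Lemma sum_sqr_sqrt_step_le (R : realType) (n : nat) : (0 < n)%N ->
  \sum_(k < n) (Num.sqrt k.+1%:R - Num.sqrt k%:R : R) ^+ 2 <=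
    4^-1 * ln n%:R + 1.
Proof.
case: n => // n _; elim: n => [|n IH].
  by rewrite big_ord_recr big_ord0 /= sqrtr0 sqrtr1 ln1 subr0 expr1n mulr0.
rewrite big_ord_recr /=; have := sqr_sqrt_step_le R n; lra.
Qed.

(** * Cauchy-Schwarz and summation by parts *)

Lemma cauchy_schwarz_sum (R : rcfType) (I : finType) (a b : I -> R) :
  \sum_i a i * b i <=
    Num.sqrt (\sum_i a i ^+ 2) * Num.sqrt (\sum_i b i ^+ 2).
Proof.
set A := \sum_i a i ^+ 2; set B := \sum_i b i ^+ 2; set P := \sum_i _.
have A0 : 0 <= A by apply: sumr_ge0 => i _; rewrite sqr_ge0.
have B0 : 0 <= B by apply: sumr_ge0 => i _; rewrite sqr_ge0.
have [BZ|Bpos] : B = 0 \/ 0 < B.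
- by case: (ltrgtP B 0) B0; [|right|left].
- suff -> : P = 0 by rewrite mulr_ge0 ?sqrtr_ge0.
  apply: big1 => i _; have /eqP := BZ.
  rewrite psumr_eq0; last by move=> j _; rewrite sqr_ge0.
  move=> /allP/(_ i (mem_index_enum _)); rewrite /= sqrf_eq0.
  by move=> /eqP ->; rewrite mulr0.
rewrite -sqrtrM // (le_trans (ler_norm P)) // -sqrtr_sqr ler_wsqrtr //.
(* Multiplication by [B] turns [A * B - P ^+ 2] into a sum of squares, hence the separate case
   [B = 0]. *)
rewrite -subr_ge0 -(pmulr_rge0 _ Bpos).
have -> : B * (A * B - P ^+ 2) = \sum_i (B * a i - P * b i) ^+ 2.
  transitivity (\sum_i (B ^+ 2 * a i ^+ 2 +
      (- (B * P *+ 2) * (a i * b i) + P ^+ 2 * b i ^+ 2))); last first.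
    by apply: eq_bigr => i _; ring.
  rewrite !big_split /= -!mulr_sumr -/A -/B -/P; ring.
by apply: sumr_ge0 => i _; rewrite sqr_ge0.
Qed.

(** By Abel summation the sum combines the prefix sums of [b] with nonnegative coefficients: the
    drops [x k - x k.+1], and the last value of [x]. *)
Lemma sum_nonincreasing_mul_ge0 (R : numDomainType) (x b : nat -> R) n :
  (forall k, (k.+1 < n)%N -> x k.+1 <= x k) ->
  (forall k, (k < n)%N -> 0 <= x k) ->
  (forall k, (k <= n)%N -> 0 <= \sum_(i < k) b i) ->
  0 <= \sum_(i < n) x i * b i.
Proof.
move=> x_dec x0 b0; case: n => [|n] in x_dec x0 b0 *; first by rewrite big_ord0.
(* Strengthening that makes summation by parts inductive. *)
suff H m : (m < n.+1)%N ->
    x m * \sum_(i < m.+1) b i <= \sum_(i < m.+1) x i * b i.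
  by apply: le_trans (H n _) => //; rewrite mulr_ge0 ?x0 ?b0.
elim: m => [|m IH] mn; first by rewrite !big_ord_recr !big_ord0 /= !add0r.
rewrite big_ord_recr [leRHS]big_ord_recr /= mulrDr lerD2r.
apply: le_trans (IH (ltnW mn)); apply: ler_wpM2r; last exact: x_dec.
by rewrite b0 // ltnW.
Qed.

(** With [U] listed by decreasing [x], the hypothesis on initial segments says that [K * d k] minus
    the [k]-th value of [a] has nonnegative prefix sums, so [a] may be replaced by [K * d] before
    Cauchy-Schwarz. *)
Lemma weighted_sum_le (R : realType) (T : finType) (U : {set T}) (K : R)
    (x a : T -> R) :
  U != set0 -> 0 <= K -> (forall i, 0 <= x i) ->
  (forall X : {set T}, X != set0 -> \sum_(i in X) a i <= K * Num.sqrt #|X|%:R) ->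
  \sum_(i in U) x i * a i <=
    K * (Num.sqrt (\sum_(i in U) x i ^+ 2) * Num.sqrt (4^-1 * ln #|U|%:R + 1)).
Proof.
move=> U0 K0 x0 aK; have /set0Pn[t0 _] := U0.
set s := sort (fun i j => x j <= x i) (enum U).
have sE (F : T -> R) : \sum_(i in U) F i = \sum_(k < #|U|) F (nth t0 s k).
  rewrite -big_enum -(perm_big _ (permEl (perm_sort (fun i j => x j <= x i) _))) /=.
  by rewrite (big_nth t0) -/s size_sort -cardE big_mkord.
have s_uniq : uniq s by rewrite sort_uniq enum_uniq.
have s_size : size s = #|U| by rewrite size_sort -cardE.
have x_dec k : (k.+1 < #|U|)%N -> x (nth t0 s k.+1) <= x (nth t0 s k).
  move=> kU; have /(sortedP t0) : sorted (fun i j => x j <= x i) s.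
    by apply: sort_sorted => i j; exact: le_total.
  by apply; rewrite s_size.
pose d k : R := Num.sqrt k.+1%:R - Num.sqrt k%:R.
have sum_d k : \sum_(i < k) d i = Num.sqrt k%:R.
  by rewrite -(big_mkord xpredT d) telescope_sumr // sqrtr0 subr0.
have prefix k : (k <= #|U|)%N -> 0 <= \sum_(i < k) (K * d i - a (nth t0 s i)).
  rewrite big_split /= -mulr_sumr sum_d sumrN subr_ge0.
  (* The empty prefix is treated apart, since the bound on [a] is assumed for nonempty sets only. *)
  case: k => [|k] kU; first by rewrite big_ord0 sqrtr0 mulr0.
  pose X := [set i in take k.+1 s].
  have takeS : size (take k.+1 s) = k.+1.
    by rewrite size_take_min s_size; apply/minn_idPl.
  have XE : #|X| = k.+1 by rewrite cardsE (card_uniqP _) ?take_uniq.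
  have := aK X; rewrite -card_gt0 XE => /(_ isT); congr (_ <= _).
  rewrite -big_enum /= (perm_big (take k.+1 s)) /=.
    rewrite (big_nth t0) takeS big_mkord; apply: eq_bigr => i _.
    by rewrite nth_take.
  by apply: uniq_perm; rewrite ?enum_uniq ?take_uniq // => i; rewrite mem_enum inE.
have := @sum_nonincreasing_mul_ge0 _ (fun k => x (nth t0 s k))
  (fun k => K * d k - a (nth t0 s k)) _ x_dec (fun k _ => x0 _) prefix.
under eq_bigr => i _ do rewrite mulrBr mulrCA.
rewrite sumrB subr_ge0 -mulr_sumr -(sE (fun i => x i * a i)) => /le_trans; apply.
apply: ler_wpM2l => //; apply: le_trans (cauchy_schwarz_sum _ _ _ _) _.
rewrite -(sE (fun i => x i ^+ 2)) ler_wpM2l ?sqrtr_ge0 // ler_wsqrtr //.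
by apply: sum_sqr_sqrt_step_le; rewrite card_gt0.
Qed.

(** * Quadratic and bilinear forms of the adjacency matrix *)

Lemma sum_enum_val (R : nmodType) (T : finType) (F : T -> R) :
  \sum_(i < #|T|) F (enum_val i) = \sum_t F t.
Proof. by rewrite [RHS](reindex _ (onW_bij _ (@enum_val_bij T))). Qed.

Lemma adjacency_form_le (R : realType) (T : finType) (adj : rel T) (x : T -> R) :
  symmetric adj -> (0 < #|T|)%N ->
  \sum_s \sum_t x s * x t * (adj s t)%:R <=
    lambda_max R adj * \sum_t x t ^+ 2.
Proof.
move=> sadj T0; have [_ lmax] := lambda_maxP R sadj T0.
have := @rayleigh_le R _ (adjacency_mx R adj) _ _ lmax (\row_i x (enum_val i)).
have -> : (adjacency_mx R adj)^T = adjacency_mx R adj.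
  by apply/matrixP => i j; rewrite !mxE sadj.
move=> /(_ erefl); rewrite -mulmxA !mxE; congr (_ <= _ * _).
  rewrite -[RHS]sum_enum_val; apply: eq_bigr => i _.
  rewrite -[X in _ = X]sum_enum_val !mxE mulr_sumr; apply: eq_bigr => j _.
  by rewrite !mxE -mulrA [_%:R * _]mulrC.
by rewrite -[RHS]sum_enum_val; apply: eq_bigr => i _; rewrite !mxE expr2.
Qed.

(** Polarization writes [4 * q x y] as the form at [x + y] minus the form at [x - y]; bounding the
    second term requires the two-sided estimate [abs_le], and the parallelogram law adds up the
    norms. *)
Lemma adjacency_bilinear_le (R : realType) (T : finType) (adj : rel T)
    (x y : T -> R) :
  symmetric adj -> (0 < #|T|)%N ->
  2 * \sum_s \sum_t x s * y t * (adj s t)%:R <=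
    lambda_max R adj * (\sum_t x t ^+ 2 + \sum_t y t ^+ 2).
Proof.
move=> sadj T0.
pose q z w : R := \sum_s \sum_t z s * w t * (adj s t)%:R.
pose N z : R := \sum_(t : T) z t ^+ 2.
have abs_le z : `|q z z| <= lambda_max R adj * N z.
  have -> : N z = N (fun t => `|z t|).
    by apply: eq_bigr => t _; rewrite real_normK ?num_real.
  apply: le_trans (adjacency_form_le _ _ _ _ sadj T0).
  apply: le_trans (ler_norm_sum _ _ _) _; apply: ler_sum => s _.
  apply: le_trans (ler_norm_sum _ _ _) _; apply: ler_sum => t _.
  by rewrite !normrM normr_nat.
have qyx : q y x = q x y.
  rewrite /q exchange_big; apply: eq_bigr => s _; apply: eq_bigr => t _.
  by rewrite sadj [y t * _]mulrC.
(* One expansion serves both signs, [e = 1] and [e = -1]. *)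
have qpm (e : R) : q (fun t => x t + e * y t) (fun t => x t + e * y t) =
    q x x + e * q x y + e * q y x + e ^+ 2 * q y y.
  rewrite /q !mulr_sumr -!big_split; apply: eq_bigr => s _.
  rewrite !mulr_sumr -!big_split; apply: eq_bigr => t _ /=; ring.
have Npm : N (fun t => x t + 1 * y t) + N (fun t => x t + -1 * y t) =
    2 * (N x + N y).
  rewrite /N -!big_split mulr_sumr; apply: eq_bigr => s _ /=; ring.
have := le_trans (ler_norm _) (abs_le (fun t => x t + 1 * y t)).
have := abs_le (fun t => x t + -1 * y t).
rewrite -normrN => /(le_trans (ler_norm _)).
rewrite !qpm qyx -/(q x y) -/(N x) -/(N y) => h1 h2.
have := congr1 (fun z => lambda_max R adj * z) Npm; rewrite mulrDr.
lra.
Qed.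

(** * Edge counts and the lower bound on the top eigenvalue *)

Lemma edge_countE (R : pzSemiRingType) (T : finType) (adj : rel T) (X Y : {set T}) :
  (edge_count adj X Y)%:R = \sum_(s in X) \sum_(t in Y) (adj s t)%:R :> R.
Proof.
rewrite /edge_count -sum1dep_card natr_sum big_mkcondr /= pair_big /=.
rewrite [in RHS]big_mkcond [in LHS]big_mkcond; apply: eq_bigr => -[s t] _ /=.
by rewrite in_setX; case: (_ && _) => //; case: (adj s t).
Qed.

Lemma edge_count_le_max_density (R : realType) (T : finType) (adj : rel T)
    (X Y : {set T}) : X != set0 -> Y != set0 ->
  (edge_count adj X Y)%:R <=
    max_density R adj * (Num.sqrt #|X|%:R * Num.sqrt #|Y|%:R).
Proof.
move=> X0 Y0; rewrite -sqrtrM ?ler0n // -natrM -ler_pdivrMr.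
  by rewrite /max_density (le_bigmax_cond _ (j := (X, Y))) //= X0 Y0.
by rewrite sqrtr_gt0 ltr0n muln_gt0 !card_gt0 X0.
Qed.

Lemma max_density_le_lambda_max (R : realType) (T : finType) (adj : rel T) :
  symmetric adj -> (0 < #|T|)%N -> max_density R adj <= lambda_max R adj.
Proof.
move=> sadj T0.
(* Required by the initial value 0 of the iterated maximum; the bilinear bound at the vectors 0 and
   1 gives it. *)
have l0 : 0 <= lambda_max R adj.
  have [/eigenvalueP[v vA v0] _] := lambda_maxP R sadj T0.
  have := adjacency_bilinear_le R T adj (fun=> 0) (fun=> 1) sadj T0.
  rewrite big1 => [|s _]; last by rewrite big1 // => t _; rewrite !mul0r.
  rewrite big1 => [|t _]; last by rewrite expr0n.
  rewrite mulr0 add0r; under eq_bigr => t _ do rewrite expr1n.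
  by rewrite sumr_const pmulr_lge0 // ltr0n.
apply: bigmax_le => // -[X Y] /= /andP[X0 Y0].
have cX : 0 < #|X|%:R :> R by rewrite ltr0n card_gt0.
have cY : 0 < #|Y|%:R :> R by rewrite ltr0n card_gt0.
rewrite ler_pdivrMr ?sqrtr_gt0 ?natrM ?mulr_gt0 // sqrtrM ?ler0n //.
set a := Num.sqrt #|X|%:R; set b := Num.sqrt #|Y|%:R.
have a0 : 0 < a by rewrite sqrtr_gt0.
have b0 : 0 < b by rewrite sqrtr_gt0.
have a2 : a ^+ 2 = #|X|%:R by rewrite sqr_sqrtr ?ltW.
have b2 : b ^+ 2 = #|Y|%:R by rewrite sqr_sqrtr ?ltW.
have sum_ind (Z : {set T}) (c : R) :
    \sum_t (c * (t \in Z)%:R) ^+ 2 = c ^+ 2 * #|Z|%:R.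
  under eq_bigr => t _ do rewrite exprMn -natrX -mulnn mulnb andbb.
  rewrite -mulr_sumr -natr_sum -sum1_card [in RHS]big_mkcond.
  by congr (_ * _%:R); apply: eq_bigr => t _; case: (t \in Z).
(* The crossed scalings give both test vectors the same squared norm [a ^+ 2 * b ^+ 2], which makes
   the arithmetic-mean bound sharp. *)
have := adjacency_bilinear_le R T adj (fun t => b * (t \in X)%:R)
  (fun t => a * (t \in Y)%:R) sadj T0.
rewrite !sum_ind -a2 -b2.
have -> : \sum_s \sum_t b * (s \in X)%:R * (a * (t \in Y)%:R) * (adj s t)%:R =
    a * b * (edge_count adj X Y)%:R.
  rewrite edge_countE [in RHS]big_mkcond mulr_sumr; apply: eq_bigr => s _.
  case: (s \in X); last by rewrite big1 ?mulr0 // => t _; rewrite !(mulr0, mul0r).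
  rewrite [in RHS]big_mkcond mulr_sumr; apply: eq_bigr => t _.
  by case: (t \in Y); rewrite !(mulr1, mulr0, mul0r) // [b * a]mulrC.
move=> h.
have e : lambda_max R adj * (b ^+ 2 * a ^+ 2 + a ^+ 2 * b ^+ 2) =
  2 * (a * b * (lambda_max R adj * (a * b))) by ring.
by move: h; rewrite e !ler_pM2l ?mulr_gt0.
Qed.

(** * The upper bound for bipartite graphs *)

(** [weighted_sum_le] is nested: its hypothesis on [U], for a set [X], is an instance of it on [W]
    with constant [max_density R adj * Num.sqrt #|X|%:R], whose own hypothesis is the density bound
    for [X] and [Y]. *)
Lemma bipartite_sum_le (R : realType) (T : finType) (adj : rel T)
    (U W : {set T}) (x : T -> R) :
  U != set0 -> W != set0 -> (forall t, 0 <= x t) ->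
  \sum_(s in U) \sum_(t in W) x s * x t * (adj s t)%:R <=
    max_density R adj *
    (Num.sqrt (4^-1 * ln #|U|%:R + 1) * Num.sqrt (4^-1 * ln #|W|%:R + 1)) *
    (Num.sqrt (\sum_(s in U) x s ^+ 2) * Num.sqrt (\sum_(t in W) x t ^+ 2)).
Proof.
move=> U0 W0 x0; have M0 : 0 <= max_density R adj by apply: bigmax_ge_id.
set cU := Num.sqrt (_ * ln #|U|%:R + 1); set cW := Num.sqrt (_ * ln #|W|%:R + 1).
set nU := Num.sqrt (\sum_(s in U) _); set nW := Num.sqrt (\sum_(s in W) _).
have -> : \sum_(s in U) \sum_(t in W) x s * x t * (adj s t)%:R =
    \sum_(s in U) x s * \sum_(t in W) x t * (adj s t)%:R.
  by apply: eq_bigr => s _; rewrite mulr_sumr; apply: eq_bigr => t _; rewrite mulrA.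
have [cU0 cW0 nU0 nW0] : [/\ 0 <= cU, 0 <= cW, 0 <= nU & 0 <= nW].
  by rewrite !sqrtr_ge0.
rewrite [leRHS](_ : _ = max_density R adj * (nW * cW) * (nU * cU)); last by ring.
apply: weighted_sum_le => // [|X X0]; first by rewrite !mulr_ge0.
rewrite exchange_big /=; under eq_bigr => t _ do rewrite -mulr_sumr.
rewrite -mulrA [_ * Num.sqrt _]mulrC mulrA.
apply: weighted_sum_le => // [|Y Y0]; first by rewrite mulr_ge0 ?sqrtr_ge0.
by rewrite exchange_big -edge_countE -mulrA edge_count_le_max_density.
Qed.

Theorem theorem1 (R : realType) (T : finType) (adj : rel T) (U W : {set T})
  (hG : simple_graph adj) (hUW : bipartition adj U W)
  (hU : U != set0) (hW : W != set0) :
  max_density R adj <= lambda_max R adj /\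
  lambda_max R adj <=
    Num.sqrt ((4^-1 * ln (#|U|%:R : R) + 1) * (4^-1 * ln (#|W|%:R : R) + 1))
      * max_density R adj.
Proof.
have [sadj _] := hG; have [UW dUW indU indW] := hUW.
have T0 : (0 < #|T|)%N.
  by have /set0Pn[t _] := hU; apply/card_gt0P; exists t.
split; first exact: max_density_le_lambda_max.
have [/eigenvalueP[v vA v0] _] := lambda_maxP R sadj T0.
pose x t := v 0 (enum_rank t).
set l := lambda_max R adj in vA *.
have xl t : \sum_s x s * (adj s t)%:R = l * x t.
  have /rowP/(_ (enum_rank t)) := vA; rewrite !mxE => <-.
  rewrite -[LHS]sum_enum_val; apply: eq_bigr => i _.
  by rewrite /x enum_valK !mxE enum_rankK.
pose N (Z : {set T}) := \sum_(t in Z) `|x t| ^+ 2.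
have split_sum (F : T -> R) : \sum_t F t = \sum_(t in U) F t + \sum_(t in W) F t.
  rewrite -bigU //; apply: eq_bigl => t.
  by have := in_setT t; rewrite -UW in_setU => tUW; rewrite [RHS]inE tUW.
have Npos : 0 < N U + N W.
  rewrite /N -split_sum lt0r sumr_ge0 ?andbT => [|t _]; last exact: sqr_ge0.
  apply: contra v0; rewrite psumr_eq0 => [/allP h|t _]; last exact: sqr_ge0.
  apply/eqP/rowP => i; rewrite mxE -(enum_valK i); apply/eqP.
  by have := h (enum_val i) (mem_index_enum _); rewrite /= sqrf_eq0 normr_eq0.
set c := Num.sqrt _; rewrite -(ler_pM2r Npos).
pose S := \sum_(s in U) \sum_(t in W) `|x s| * `|x t| * (adj s t)%:R.
(* The eigenvector may change sign, so its form is compared with that of its absolute values. There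
   only edges between [U] and [W] contribute, each in both orders, whence the factor 2. *)
have lS : l * (N U + N W) <= 2 * S.
  have -> : l * (N U + N W) = \sum_s \sum_t x s * x t * (adj s t)%:R.
    rewrite /N -split_sum exchange_big mulr_sumr; apply: eq_bigr => t _.
    rewrite real_normK ?num_real // expr2 mulrA -xl mulr_suml.
    by apply: eq_bigr => s _; rewrite mulrAC.
  have -> : 2 * S = \sum_s \sum_t `|x s| * `|x t| * (adj s t)%:R.
    have zero (Z : {set T}) : {in Z &, forall s t, ~~ adj s t} ->
        \sum_(s in Z) \sum_(t in Z) `|x s| * `|x t| * (adj s t)%:R = 0.
      move=> indZ; apply: big1 => s sZ; apply: big1 => t tZ.
      by rewrite (negbTE (indZ s t sZ tZ)) mulr0.
    rewrite split_sum; under eq_bigr => s _ do rewrite split_sum.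
    under [X in _ + X]eq_bigr => s _ do rewrite split_sum.
    rewrite !big_split /= !zero // add0r addr0 mulr_natl mulr2n; congr (_ + _).
    rewrite exchange_big; apply: eq_bigr => s _; apply: eq_bigr => t _.
    by rewrite sadj [`|x s| * _]mulrC.
  apply: ler_sum => s _; apply: ler_sum => t _; apply: le_trans (ler_norm _) _.
  by rewrite !normrM normr_nat.
have M0 : 0 <= max_density R adj by apply: bigmax_ge_id.
have lnge0 (Z : {set T}) : Z != set0 -> 0 <= 4^-1 * ln #|Z|%:R + 1 :> R.
  rewrite -card_gt0 => Z0; rewrite addr_ge0 // mulr_ge0 ?invr_ge0 //.
  by rewrite ln_ge0 ?ler1n.
have := bipartite_sum_le R T adj U W (fun t => `|x t|) hU hW (fun t => normr_ge0 _).
rewrite -/S -sqrtrM ?lnge0 // -/c -/(N U) -/(N W).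
have N0 Z : 0 <= N Z by apply: sumr_ge0 => t _; exact: sqr_ge0.
set a := Num.sqrt (N U); set b := Num.sqrt (N W) => hS.
have a2 : a ^+ 2 = N U by rewrite sqr_sqrtr.
have b2 : b ^+ 2 = N W by rewrite sqr_sqrtr.
apply: le_trans lS _; rewrite -a2 -b2.
have cM0 : 0 <= c * max_density R adj by rewrite mulr_ge0 ?sqrtr_ge0.
(* [2 a b <= a^2 + b^2] *)
have := mulr_ge0 cM0 (sqr_ge0 (a - b)); nra.
Qed.
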